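(* Let $\vec m\in\mathbb R^N$. Then $\vec m\in S^{\psi}_I$ if and only if $$\Xi_0(\vec p)-\vec m\cdot\vec p\ \ge 0\quad\text{for every }\vec p\in\mathbb R^N .$$ Likewise, $\vec m\in\underline S^{\psi}_I$ if and only if $$\Xi_0^+(\vec p)-\vec m\cdot\vec p\ \ge 0\quad\text{for every }\vec p\in\mathbb R^N .$$
   Context: $X$ is a compact Polish space with Borel $\sigma$-algebra $\mathcal B$, $\mu$ is a non-atomic Borel probability measure on $X$, $I=\{1,\dots,N\}$, and $\psi_1,\dots,\psi_N:X\to\mathbb R$ are continuous. $\vec m\cdot\vec p=\sum_{i=1}^N m_ip_i$. $S^{\psi}_I$ is the set of $\vec m\in\mathbb R^N$ for which there are sets $X_1,\dots,X_N\in\mathcal B$ with $\bigcup_i X_i=X$, $\mu(X_i\cap X_j)=0$ for $i\ne j$, and $\int_{X_i}\psi_i\,d\mu=m_i$ for all $i\in I$. $\underline S^{\psi}_I$ is defined in the same way with $\bigcup_iX_i=X$ replaced by $\bigcup_iX_i\subseteq X$. For $\vec p\in\mathbb R^N$ and $x\in X$: $\xi_0(x,\vec p)=\max_{i\in I}p_i\psi_i(x)$, $\xi_0^+(x,\vec p)=\max(\xi_0(x,\vec p),0)$, $\Xi_0(\vec p)=\int_X\xi_0(x,\vec p)\,d\mu(x)$, $\Xi_0^+(\vec p)=\int_X\xi_0^+(x,\vec p)\,d\mu(x)$. *)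

(* Defs.v *)
From HB Require Import structures.
From mathcomp Require Import all_boot all_order all_algebra.
From mathcomp Require Import all_classical all_reals all_analysis.

Set Implicit Arguments.
Unset Strict Implicit.
Unset Printing Implicit Defensive.

Import Order.TTheory GRing.Theory Num.Theory.
Import numFieldNormedType.Exports.

Local Open Scope classical_set_scope.
Local Open Scope ring_scope.

Section Polish.
Context {R : realType} {X : topologicalType}.

Definition is_metric (d : X -> X -> R) : Prop :=
  [/\ forall x y, 0 <= d x y,
      forall x y, d x y = 0 <-> x = y,
      forall x y, d x y = d y x
    & forall x y z, d x z <= d x y + d y z].

Definition induces_topology (d : X -> X -> R) : Prop :=
  forall x : X,
    nbhs x = filter_from [set e : R | 0 < e] (fun e => [set y | d x y < e]).

Definition complete_metric (d : X -> X -> R) : Prop :=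
  forall u : nat -> X,
    (forall e : R, 0 < e ->
       exists k, forall i j, (k <= i)%N -> (k <= j)%N -> d (u i) (u j) < e) ->
    exists l : X, forall e : R, 0 < e ->
      exists k, forall i, (k <= i)%N -> d (u i) l < e.

End Polish.

Definition polish_space (R : realType) (X : topologicalType) : Prop :=
  (exists2 D : set X, countable D & dense D) /\
  (exists d : X -> X -> R,
    [/\ is_metric d, induces_topology d & complete_metric d]).

Notation borelType X := (g_sigma_algebraType (@open X)).

Section Atoms.
Context {d : measure_display} {T : measurableType d} {R : realType}.
Variable mu : {measure set T -> \bar R}.

Definition is_atom (A : set T) : Prop :=
  [/\ measurable A, (0 < mu A)%E
    & forall B, measurable B -> B `<=` A -> (mu B < mu A)%E -> mu B = 0%E].

Definition nonatomic : Prop := forall A : set T, ~ is_atom A.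

End Atoms.

(* I = {1, ..., N} is rendered as 'I_n.+1, with N = n.+1: the maximum over I
   requires N >= 1. *)
Section Partitions.
Context {R : realType} {X : ptopologicalType} {n : nat}.
Variables (mu : probability (borelType X) R) (psi : 'I_n.+1 -> X -> R).

Definition dotv (m p : 'rV[R]_n.+1) : R := \sum_(i < n.+1) m ord0 i * p ord0 i.

Definition partition_set : set 'rV[R]_n.+1 :=
  [set m | exists A : 'I_n.+1 -> set (borelType X),
    [/\ forall i, measurable (A i),
        \bigcup_i A i = [set: X],
        forall i j, i != j -> mu (A i `&` A j) = 0%E
      & forall i, \int[mu]_(x in A i) psi i x = m ord0 i]].

Definition subpartition_set : set 'rV[R]_n.+1 :=
  [set m | exists A : 'I_n.+1 -> set (borelType X),
    [/\ forall i, measurable (A i),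
        \bigcup_i A i `<=` [set: X],
        forall i j, i != j -> mu (A i `&` A j) = 0%E
      & forall i, \int[mu]_(x in A i) psi i x = m ord0 i]].

(* The seed of the iterated maximum is itself one of the terms, so this is
   exactly the maximum over the index set. *)
Definition xi0 (x : X) (p : 'rV[R]_n.+1) : R :=
  \big[Num.max/p ord0 ord0 * psi ord0 x]_(i < n.+1) (p ord0 i * psi i x).

Definition xi0_plus (x : X) (p : 'rV[R]_n.+1) : R := Num.max (xi0 x p) 0.

Definition Xi0 (p : 'rV[R]_n.+1) : R := \int[mu]_x xi0 x p.

Definition Xi0_plus (p : 'rV[R]_n.+1) : R := \int[mu]_x xi0_plus x p.

End Partitions.

(* Main.v *)
Require Import Defs.
From HB Require Import structures.
From mathcomp Require Import all_boot all_order all_algebra.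
From mathcomp Require Import all_classical all_reals all_analysis.
From mathcomp Require Import finmap ring lra measurable_realfun.

Set Implicit Arguments.
Unset Strict Implicit.
Unset Printing Implicit Defensive.

Import Order.TTheory GRing.Theory Num.Theory.
Import numFieldNormedType.Exports.

Local Open Scope classical_set_scope.
Local Open Scope ring_scope.

(** A partition of the space amounts to a measurable selector: a function [a]
with values in the index set, whose fibres are the cells. Its payoff is the
vector of the integrals of [psi i] over the fibres, and [p] paired with this
payoff is the integral of [p_(a x) psi_(a x) x]. This is largest when [a x]
maximizes [p_i psi_i x], where it equals [Xi0 p]. So [Xi0] is the support
function of the set of payoffs, and the theorem says that this set contains
every vector that its support function does not exclude: it is closed and
convex.

Convexity is a form of Lyapunov's theorem, [lyapunov_scaling]: finitely many
bounded densities can all be scaled by the same [t] by restricting them to one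
set. It is proved by induction on the number of densities. If every set can be
halved fairly for the first [k] densities, then repeated halving gives an
increasing family [E t], [0 <= t <= 1], carrying the fraction [t] of each of
them; all the windows from [E s] to [E (s + 1/2)] are fair halves for those, and
the intermediate value theorem picks a window that also halves the next density.
The base case, halving the measure itself, is Sierpinski's theorem on non-atomic
measures.

Closedness is replaced by a descent on faces, [unseparated_attained], which
avoids any compactness of the set of partitions. Suppose that no [p] separates
[m] from the payoffs, but [m] is not a payoff. A convex set in finite dimension
which misses [m] has a supporting functional [p] at [m], even if [m] is in its
closure, and [p] can be taken orthogonal to all directions in which the set is
already known to be constant ([support_functional]). As [p] does not strictly
separate, [m] lies on the face exposed by [p]. That face is again a set of
payoffs, for selectors confined to the maximizers of [p_i psi_i x], and [m] is
still not separated from it: maximize [q + k p] and let [k] tend to infinity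
([unseparated_face]). Each step adds a new direction on which the payoffs are
constant, so the dimension bounds the number of steps.

For families of sets that need not cover the space, an extra index with zero
function and zero target absorbs the complement of the union; the maximum over
the enlarged index set is the positive part of the original one. *)

(** * Supporting functionals of convex sets *)

Lemma continuous_rsum {R : realType} (T : topologicalType) (I : Type) (r : seq I)
    (f : I -> T -> R) : (forall i, continuous (f i)) ->
  continuous (fun x => \sum_(i <- r) f i x).
Proof. by move=> cf; apply: (continuous_big add_continuous). Qed.

Lemma continuous_rmul {R : realType} (T : topologicalType) (f g : T -> R) :
  continuous f -> continuous g -> continuous (fun x => f x * g x).
Proof. by move=> cf cg x; apply: cvgM; [exact: cf|exact: cg]. Qed.

Section Dot.
Context {R : realType} {n : nat}.
Implicit Types x y p : 'rV[R]_n.+1.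

Lemma dotvE x p : dotv x p = (x *m p^T) ord0 ord0.
Proof. by rewrite mxE; apply: eq_bigr => i _; rewrite mxE. Qed.

Lemma dotvC x p : dotv x p = dotv p x.
Proof. by apply: eq_bigr => i _; rewrite mulrC. Qed.

Lemma dotvDl x y p : dotv (x + y) p = dotv x p + dotv y p.
Proof. by rewrite !dotvE mulmxDl mxE. Qed.

Lemma dotvZl a x p : dotv (a *: x) p = a * dotv x p.
Proof. by rewrite !dotvE -scalemxAl mxE. Qed.

Lemma dotvNl x p : dotv (- x) p = - dotv x p.
Proof. by rewrite -scaleN1r dotvZl mulN1r. Qed.

Lemma dotvDr x p y : dotv x (p + y) = dotv x p + dotv x y.
Proof. by rewrite dotvC dotvDl !(dotvC x). Qed.

Lemma dotvZr a x p : dotv x (a *: p) = a * dotv x p.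
Proof. by rewrite dotvC dotvZl (dotvC x). Qed.

Lemma dotv_ge0 x : 0 <= dotv x x.
Proof. by apply: sumr_ge0 => i _; rewrite -expr2 sqr_ge0. Qed.

Lemma dotv_eq0 x : (dotv x x == 0) = (x == 0).
Proof.
apply/eqP/eqP => [x0|->]; last by rewrite /dotv big1// => i _; rewrite mxE mul0r.
apply/rowP => i; rewrite mxE; apply/eqP; rewrite -[_ == _]orbb -mulf_eq0.
move/eqP: x0; rewrite psumr_eq0; last by move=> j _; rewrite -expr2 sqr_ge0.
by move=> /allP/(_ i); rewrite mem_index_enum => /(_ isT).
Qed.

Lemma continuous_dotv p : continuous (fun x => dotv x p).
Proof.
apply: continuous_rsum => i; apply: continuous_rmul.
  exact: coord_continuous.
exact: cst_continuous.
Qed.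

End Dot.

Section Separation.
Context {R : realType}.

Definition convex_rV N (C : set 'rV[R]_N) :=
  forall a b t, C a -> C b -> 0 <= t <= 1 -> C (t *: a + (1 - t) *: b).

Lemma convex_comb N (C : set 'rV[R]_N) r (v : 'I_r.+1 -> 'rV[R]_N)
    (l : 'I_r.+1 -> R) : convex_rV C -> (forall i, C (v i)) ->
  (forall i, 0 <= l i) -> \sum_i l i = 1 -> C (\sum_i l i *: v i).
Proof.
move=> cC; elim: r v l => [|r IH] v l Cv l0.
  by rewrite !big_ord_recl !big_ord0 !addr0 => ->; rewrite scale1r.
rewrite big_ord_recl => l1; rewrite big_ord_recl.
have s0 : 0 <= \sum_(i < r.+1) l (lift ord0 i) by apply: sumr_ge0.
have [s1|s1] := eqVneq (\sum_(i < r.+1) l (lift ord0 i)) 0.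
  rewrite [X in _ + X]big1 ?addr0; last first.
    move=> i _; have/eqP := s1; rewrite psumr_eq0// => /allP/(_ i).
    by rewrite mem_index_enum => /(_ isT)/eqP->; rewrite scale0r.
  by move: l1; rewrite s1 addr0 => ->; rewrite scale1r.
set s := \sum_(i < r.+1) l (lift ord0 i) in s0 s1 l1 *.
have := IH (fun i => v (lift ord0 i)) (fun i => l (lift ord0 i) / s).
move=> /(_ (fun i => Cv _) (fun i => divr_ge0 (l0 _) s0)).
rewrite -mulr_suml divff// => /(_ erefl) Cr.
have -> : \sum_(i < r.+1) l (lift ord0 i) *: v (lift ord0 i) =
    (1 - l ord0) *: \sum_(i < r.+1) (l (lift ord0 i) / s) *: v (lift ord0 i).
  rewrite scaler_sumr; apply: eq_bigr => i _; rewrite scalerA.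
  have -> : 1 - l ord0 = s by rewrite -l1 addrAC subrr add0r.
  by rewrite mulrC divfK.
apply: cC => //; rewrite l0 -l1 lerDl.
exact: s0.
Qed.

(** The point of the hull nearest to the origin exists because the simplex of
weights is compact; moving from it towards a vertex cannot decrease the norm,
and the derivative of the squared norm along this move is the inequality. *)
Lemma finite_hull_nearest n r (v : 'I_r.+1 -> 'rV[R]_n.+1) :
  exists l : 'I_r.+1 -> R, [/\ forall i, 0 <= l i, \sum_i l i = 1 &
   let c := \sum_i l i *: v i in forall j, dotv c c <= dotv c (v j)].
Proof.
pose A := [set l : 'rV[R]_r.+1 | (forall i, 0 <= l ord0 i) /\ \sum_i l ord0 i = 1].
pose F (l : 'rV[R]_r.+1) : 'rV[R]_n.+1 := \sum_i l ord0 i *: v i.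
have cF : continuous (fun l => dotv (F l) (F l)).
  have cFj j : continuous (fun l => F l ord0 j).
    under eq_fun do rewrite /F summxE.
    apply: continuous_rsum => i; under eq_fun do rewrite mxE.
    by apply: continuous_rmul; [exact: coord_continuous|exact: cst_continuous].
  by apply: continuous_rsum => j; apply: continuous_rmul.
have A0 : A !=set0.
  exists (delta_mx ord0 ord0); split => [i|].
    by rewrite mxE; case: (_ && _).
  rewrite (bigD1 ord0)//= mxE !eqxx/= big1 ?addr0// => i i0.
  by rewrite mxE eqxx/= (negbTE i0).
have cA : compact A.
  apply: bounded_closed_compact.
    exists 1; split => // M M1 l [l0 l1] /=.
    rewrite /Num.norm/= mx_normrE; apply: bigmax_le; first exact: ltW (lt_trans _ M1).
    move=> [i j] _ /=; rewrite (ord1 i) ger0_norm//; apply: le_trans (ltW M1).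
    by rewrite -l1 (bigD1 j)//= lerDl sumr_ge0.
  have -> : A = \bigcap_i [set l : 'rV[R]_r.+1 | 0 <= l ord0 i] `&`
                [set l : 'rV[R]_r.+1 | \sum_i l ord0 i = 1].
    apply/seteqP; split => l /=; first by move=> [l0 l1]; split=> // i _; exact: l0.
    by move=> [l0 l1]; split => // i; exact: l0.
  apply: closedI.
    apply: closed_bigI => i _.
    apply: (@preimage_closed _ _ (fun l : 'rV[R]_r.+1 => l ord0 i) [set x | 0 <= x]).
      by move=> x _; apply: coord_continuous.
    exact: closed_ge.
  apply: (@preimage_closed _ _ (fun l : 'rV[R]_r.+1 => \sum_i l ord0 i) [set x | x = 1]).
    by move=> x _; move: x; apply: continuous_rsum => i; apply: coord_continuous.
  exact: closed_eq.
have [l /set_mem [l0 l1] lmin] := EVT_min_rV A0 cA (continuous_subspaceT cF).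
exists (fun i => l ord0 i); split => // c j.
have key t : 0 <= t <= 1 ->
    dotv c c <= dotv (c + t *: (v j - c)) (c + t *: (v j - c)).
  move=> /andP[t0 t1].
  have := lmin (l + t *: (delta_mx ord0 j - l)).
  have -> : F (l + t *: (delta_mx ord0 j - l)) = c + t *: (v j - c).
    rewrite /F; under eq_bigr do rewrite !mxE scalerDl -scalerA scalerBl.
    rewrite big_split/= -scaler_sumr sumrB; congr (_ + _ *: (_ - _)).
    rewrite (bigD1 j)//= !eqxx scale1r big1 ?addr0// => i ij.
    by rewrite (negbTE ij) ?andbF scale0r.
  apply; apply/mem_set; split => [i|].
    rewrite !mxE.
    have -> : forall a b : R, a + t * (b - a) = (1 - t) * a + t * b by move=> a b; ring.
    by rewrite addr_ge0// mulr_ge0// ?subr_ge0//; case: (_ && _).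
  under eq_bigr do rewrite !mxE.
  rewrite big_split/= -mulr_sumr sumrB l1.
  rewrite (bigD1 j)//= !eqxx big1 ?addr0 ?subrr ?mulr0 ?addr0// => i ij.
  by rewrite (negbTE ij) ?andbF.
rewrite -subr_ge0; set D := _ - _.
have vc : dotv c (v j - c) = D by rewrite -scaleN1r dotvDr dotvZr mulN1r.
set w := v j - c in key vc.
clearbody D w.
have key2 t : 0 < t <= 1 -> 0 <= 2 * D + t * dotv w w.
  move=> /andP[t0 t1]; have := key t; rewrite (ltW t0) t1 => /(_ isT).
  rewrite !(dotvDl, dotvDr) !(dotvZl, dotvZr) (dotvC w c) vc.
  rewrite -subr_ge0 => h.
  rewrite -(pmulr_rge0 _ t0); apply: le_trans h _.
  by rewrite le_eqVlt; apply/orP; left; apply/eqP; ring.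
rewrite leNgt; apply/negP => D0.
have w0 := dotv_ge0 w.
have wD : 0 < dotv w w - D by lra.
(* If [D < 0], this [t] lies in (0, 1] and is small enough for the linear term
to dominate the quadratic one. *)
have := key2 (- D / (dotv w w - D)).
rewrite divr_gt0 ?oppr_gt0//= ler_pdivrMr// mul1r.
have -> : - D <= dotv w w - D by lra.
move=> /(_ isT); rewrite -(pmulr_lge0 _ wD) mulrDl.
have -> : - D / (dotv w w - D) * dotv w w * (dotv w w - D) = - D * dotv w w.
  by field; rewrite gt_eqF.
nra.
Qed.

(** [C] may have the origin in its closure, so that a strict separation need not
exist; the weak one must be kept nonzero. This is achieved by looking for [p] on
the unit sphere: if every unit [p] is beaten by some point of [C], then by
compactness finitely many points of [C] beat them all, and the nearest point to
the origin in their hull gives a contradiction once it is negated and normalized. Searching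
only among the vectors orthogonal to [V] costs nothing, because that nearest
point is itself orthogonal to [V]. *)
Lemma support_functional n (C V : set 'rV[R]_n.+1) :
  convex_rV C -> C !=set0 -> ~ C 0 ->
  (forall s u, C s -> V u -> dotv s u = 0) ->
  exists p, [/\ p != 0, forall u, V u -> dotv p u = 0 &
    forall s, C s -> dotv s p <= 0].
Proof.
move=> cC [s0 Cs0] C0 CV.
pose K := [set p : 'rV[R]_n.+1 | dotv p p = 1 /\ forall u, V u -> dotv p u = 0].
have cK : compact K.
  apply: bounded_closed_compact.
    exists 1; split => // M M1 p [p1 _] /=.
    rewrite /Num.norm/= mx_normrE; apply: bigmax_le; first exact: ltW (lt_trans _ M1).
    move=> [i j] _ /=; rewrite (ord1 i); apply: le_trans (ltW M1).
    rewrite -(@expr_le1 _ 2)// real_normK ?num_real//.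
    by rewrite -p1 /dotv (bigD1 j)//= expr2 lerDl sumr_ge0// => k _; rewrite -expr2 sqr_ge0.
  have -> : K = [set p | dotv p p = 1] `&` \bigcap_(u in V) [set p | dotv p u = 0].
    by apply/seteqP; split.
  apply: closedI.
    apply: (@preimage_closed _ _ (fun p : 'rV[R]_n.+1 => dotv p p) [set x | x = 1]).
      move=> x _; move: x; apply: continuous_rsum => i.
      by apply: continuous_rmul; apply: coord_continuous.
    exact: closed_eq.
  apply: closed_bigI => u _.
  apply: (@preimage_closed _ _ (fun p : 'rV[R]_n.+1 => dotv p u) [set x | x = 0]).
    by move=> x _; apply: continuous_dotv.
  exact: closed_eq.
apply: contrapT => noP.
have cov p : K p -> exists2 s, C s & 0 < dotv s p.
  move=> [p1 pV]; apply: contrapT => noS; apply: noP; exists p; split => //.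
    by rewrite -dotv_eq0 p1 oner_eq0.
  move=> s Cs; rewrite leNgt; apply/negP => sp; apply: noS; by exists s.
have := cK; rewrite compact_cover => /(_ _ C (fun s => [set p | 0 < dotv s p])).
case.
- move=> s _; rewrite (_ : [set _ | _] = (fun p => dotv p s) @^-1` [set x | x > 0]).
    by apply: open_comp (@open_gt _ 0) => p _; apply: continuous_dotv.
  by apply/seteqP; split => p /=; rewrite dotvC.
- by move=> p /cov[s Cs sp]; exists s.
move=> F FC Fcov.
(* [s0] is added to the finite family to make it nonempty. *)
pose v (i : 'I_(size (enum_fset F)).+1) := nth 0 (s0 :: enum_fset F) i.
have Cv i : C (v i).
  rewrite /v; case: i => -[|i]//= iF.
  by apply: set_mem; apply: FC; exact: (mem_nth 0).
have [l [l0 l1 lc]] := finite_hull_nearest v.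
set c := \sum_i _ in lc.
have Cc : C c by apply: convex_comb.
have c0 : c != 0 by apply/eqP => c0; apply: C0; rewrite -c0.
have cc : 0 < dotv c c by rewrite lt_def dotv_eq0 c0 dotv_ge0.
pose a := Num.sqrt (dotv c c).
have a0 : 0 < a by rewrite sqrtr_gt0.
have Kp : K (- a^-1 *: c).
  split; last by move=> u Vu; rewrite dotvZl CV// mulr0.
  rewrite dotvZl dotvZr mulrA mulrNN -invfM -expr2 sqr_sqrtr ?dotv_ge0//.
  by rewrite mulVf// gt_eqF.
have [s sF /=] := Fcov _ Kp.
rewrite dotvZr mulNr oppr_gt0 pmulr_rlt0 ?invr_gt0// ltNge => /negP; apply.
have sF' : s \in enum_fset F by [].
have iF : ((index s (enum_fset F)).+1 < (size (enum_fset F)).+1)%N by rewrite ltnS index_mem.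
have := lc (Ordinal iF); rewrite /v/= nth_index// dotvC; apply: le_trans.
exact: dotv_ge0.
Qed.

End Separation.

(** * Integrals of bounded measurable functions *)

Section BoundedMeasurable.
Context {d : measure_display} {T : measurableType d} {R : realType}.
Implicit Types (f g : T -> R) (A : set T).

Definition bounded_measurable f :=
  measurable_fun setT f /\ exists M : R, forall x, `|f x| <= M.

Lemma bmeas_cst c : bounded_measurable (fun=> c).
Proof. by split; [exact: measurable_cst|exists `|c|]. Qed.

Lemma bmeasD f g : bounded_measurable f -> bounded_measurable g ->
  bounded_measurable (fun x => f x + g x).
Proof.
move=> [mf [M fM]] [mg [N gN]]; split; first exact: measurable_funD.
by exists (M + N) => x; apply: le_trans (ler_normD _ _) _; apply: lerD.
Qed.

Lemma bmeasM f g : bounded_measurable f -> bounded_measurable g ->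
  bounded_measurable (fun x => f x * g x).
Proof.
move=> [mf [M fM]] [mg [N gN]]; split; first exact: measurable_funM.
by exists (M * N) => x; rewrite normrM ler_pM.
Qed.

Lemma bmeasB f g : bounded_measurable f -> bounded_measurable g ->
  bounded_measurable (fun x => f x - g x).
Proof.
move=> bf bg; under eq_fun do rewrite -mulN1r.
by apply: bmeasD => //; apply: bmeasM => //; exact: bmeas_cst.
Qed.

Lemma bmeas_indic A : measurable A -> bounded_measurable (\1_A : T -> R).
Proof.
move=> mA; split; first exact: measurable_indic.
by exists 1 => x; rewrite indicE; case: (_ \in _); rewrite ?normr1 ?normr0.
Qed.

Lemma bmeas_bool (b : T -> bool) : measurable [set x | b x] ->
  bounded_measurable (fun x => (b x)%:R : R).
Proof.
move=> mb; rewrite (_ : (fun _ => _) = \1_[set x | b x]); first exact: bmeas_indic.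
apply/funext => x; rewrite indicE; congr ((nat_of_bool _)%:R).
by apply/idP/idP => [bx|/set_mem]//; exact: mem_set.
Qed.

Lemma bmeas_sum (I : Type) (r : seq I) (h : I -> T -> R) :
  (forall i, bounded_measurable (h i)) ->
  bounded_measurable (fun x => \sum_(i <- r) h i x).
Proof.
move=> bh; elim: r => [|i r IH].
  by under eq_fun do rewrite big_nil; exact: bmeas_cst.
by under eq_fun do rewrite big_cons; exact: bmeasD.
Qed.

Variable mu : probability T R.
Local Notation Int f := (Rintegral mu setT f).

Lemma bmeas_integrable f : bounded_measurable f -> mu.-integrable setT (EFin \o f).
Proof.
move=> [mf [M fM]]; apply: measurable_bounded_integrable => //.
  by rewrite -ge0_fin_numE //; exact: fin_num_measure.
by exists M; split; [exact: num_real|move=> N MN x _; apply: le_trans (ltW MN)].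
Qed.

Lemma IntD f g : bounded_measurable f -> bounded_measurable g ->
  Int (fun x => f x + g x) = Int f + Int g.
Proof. by move=> bf bg; apply: RintegralD => //; exact: bmeas_integrable. Qed.

Lemma IntB f g : bounded_measurable f -> bounded_measurable g ->
  Int (fun x => f x - g x) = Int f - Int g.
Proof. by move=> bf bg; apply: RintegralB => //; exact: bmeas_integrable. Qed.

Lemma IntZ c f : bounded_measurable f -> Int (fun x => c * f x) = c * Int f.
Proof. by move=> bf; apply: RintegralZl => //; exact: bmeas_integrable. Qed.

Lemma Int_cst c : Int (fun=> c) = c.
Proof. by rewrite Rintegral_cst// [X in fine X](probability_setT mu) mulr1. Qed.

Lemma Int_sum (I : Type) (r : seq I) (h : I -> T -> R) :
  (forall i, bounded_measurable (h i)) ->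
  Int (fun x => \sum_(i <- r) h i x) = \sum_(i <- r) Int (h i).
Proof.
move=> bh; elim: r => [|i r IH].
  by rewrite big_nil -[RHS]Int_cst; congr Rintegral; apply/funext => x; rewrite big_nil.
rewrite big_cons -IH -IntD//; last exact: bmeas_sum.
by congr Rintegral; apply/funext => x; rewrite big_cons.
Qed.

Lemma le_Int f g : bounded_measurable f -> bounded_measurable g ->
  (forall x, f x <= g x) -> Int f <= Int g.
Proof. by move=> bf bg fg; apply: le_Rintegral => //; exact: bmeas_integrable. Qed.

Lemma Int_indic A : measurable A -> Int \1_A = fine (mu A).
Proof. by move=> mA; rewrite /Rintegral integral_indic// setIT. Qed.

Lemma Int_setE A f : \int[mu]_(x in A) f x = Int (fun x => \1_A x * f x).
Proof.
rewrite Rintegral_mkcond; congr Rintegral; apply/funext => x.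
by rewrite patchE indicE; case: (_ \in _); rewrite ?mul1r ?mul0r.
Qed.

Lemma Int_indicD f A B : bounded_measurable f -> measurable A -> measurable B ->
  B `<=` A -> Int (fun x => \1_(A `\` B) x * f x) =
    Int (fun x => \1_A x * f x) - Int (fun x => \1_B x * f x).
Proof.
move=> bf mA mB BA; rewrite -IntB; try by apply: bmeasM => //; exact: bmeas_indic.
congr Rintegral; apply/funext => x; rewrite -mulrBl; congr (_ * _).
rewrite !indicE in_setD; have [xB|xB] := boolP (x \in B); last by rewrite andbT subr0.
by rewrite andbF; have /mem_set -> := BA _ (set_mem xB); rewrite subrr.
Qed.

Lemma Int_norm_le f A M : bounded_measurable f -> measurable A ->
  (forall x, `|f x| <= M) -> `|Int (fun x => \1_A x * f x)| <= M * fine (mu A).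
Proof.
move=> bf mA fM; have bA := bmeas_indic mA.
have b1 : bounded_measurable (fun x => M * \1_A x).
  by apply: bmeasM => //; exact: bmeas_cst.
have b2 : bounded_measurable (fun x => - M * \1_A x).
  by apply: bmeasM => //; exact: bmeas_cst.
rewrite -Int_indic// ler_norml -mulNr -!IntZ//.
apply/andP; split; apply: le_Int => //; try exact: bmeasM.
  move=> x; have := fM x; rewrite ler_norml => /andP[+ _].
  by rewrite indicE; case: (_ \in _); rewrite ?mulr1 ?mul1r ?mulr0 ?mul0r.
move=> x; have := fM x; rewrite ler_norml => /andP[_ +].
by rewrite indicE; case: (_ \in _); rewrite ?mulr1 ?mul1r ?mulr0 ?mul0r.
Qed.

(** Dominated convergence in the only form used below, where the functions are
indicators or selections among finitely many functions and hence become
stationary at each point. *)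
Lemma cvg_Int_eventually (f_ : nat -> T -> R) f M :
  (forall n, bounded_measurable (f_ n)) -> bounded_measurable f ->
  (forall n x, `|f_ n x| <= M) -> (forall x, \forall n \near \oo, f_ n x = f x) ->
  Int (f_ n) @[n --> \oo] --> Int f.
Proof.
move=> bf_ bf fM fe; rewrite /Rintegral.
have [|||||_ _ H] := @dominated_convergence _ T R mu setT measurableT
  (fun n => EFin \o f_ n) (EFin \o f) (EFin \o (fun=> M)).
- by move=> n; apply/measurable_EFinP; exact: (bf_ n).1.
- by apply/measurable_EFinP; exact: bf.1.
- apply: aeW => x _; apply: cvg_near_cst.
  by near=> n; congr EFin; near: n; exact: fe.
- exact: bmeas_integrable (bmeas_cst M).
- by apply: aeW => x n _; rewrite /= lee_fin.
- apply: (@fine_cvg _ _ _ _ (fun n => \int[mu]_x (f_ n x)%:E)%E).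
  by rewrite fineK//; apply: integrable_fin_num => //; exact: bmeas_integrable.
Unshelve. all: by end_near. Qed.

End BoundedMeasurable.

(** * Sierpinski's theorem for non-atomic measures *)

Section Sierpinski.
Context {d : measure_display} {T : measurableType d} {R : realType}.
Variable mu : probability T R.
Implicit Types (A B E : set T).

Local Notation m A := (fine (mu A)).

Lemma fmu_ge0 A : 0 <= m A. Proof. by rewrite fine_ge0. Qed.

Lemma fmuU A B : measurable A -> measurable B -> A `&` B = set0 ->
  m (A `|` B) = m A + m B.
Proof. by move=> mA mB AB; rewrite measureU// fineD// fin_num_measure. Qed.

Lemma fmuD A B : measurable A -> measurable B -> B `<=` A ->
  m (A `\` B) = m A - m B.
Proof.
move=> mA mB BA; rewrite -{2}(setDUK BA) fmuU; first by ring.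
- exact: mB.
- exact: measurableD.
- by rewrite setDE setICA setICr setI0.
Qed.

Lemma le_fmu A B : measurable A -> measurable B -> A `<=` B -> m A <= m B.
Proof. by move=> mA mB AB; rewrite -subr_ge0 -fmuD// fmu_ge0. Qed.

Hypothesis hmu : nonatomic mu.

(** A set of positive measure that is not an atom splits into two parts of
positive measure, one of which has at most half of the measure; iterate. *)
Lemma nonatomic_small_subset A e : measurable A -> 0 < m A -> 0 < e ->
  exists B, [/\ measurable B, B `<=` A & 0 < m B < e].
Proof.
move=> mA A0 e0.
have split_half C : measurable C -> 0 < m C ->
    exists B, [/\ measurable B, B `<=` C & 0 < m B <= m C / 2].
  move=> mC C0.
  have [B [mB BC B0 BltC]] : exists B, [/\ measurable B, B `<=` C, 0 < m B & m B < m C].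
    apply: contrapT => noB; apply: (hmu (A := C)); split => //.
      suff : (0%:E < (m C)%:E)%E by rewrite fineK// fin_num_measure.
      by rewrite lte_fin.
    move=> B mB BC BltC; apply: contrapT => B0; apply: noB; exists B; split => //.
      rewrite lt_def fmu_ge0 andbT; apply/eqP => mB0; apply: B0.
      by have := fineK (fin_num_measure mu B mB); rewrite mB0 => h; exact: esym h.
    by rewrite -lte_fin !fineK// fin_num_measure.
  have [h|h] := leP (m B) (m C / 2).
    by exists B; split => //; rewrite B0 h.
  exists (C `\` B); split; [exact: measurableD|exact: subDsetl|].
  by rewrite fmuD// subr_gt0 BltC/=; lra.
have {}iter n : exists B, [/\ measurable B, B `<=` A & 0 < m B <= m A / 2 ^+ n].
  elim: n => [|n [B [mB BA /andP[B0 Bn]]]].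
    by exists A; split => //; rewrite A0 expr0 divr1 lexx.
  have [C [mC CB /andP[C0 Cn]]] := split_half B mB B0.
  exists C; split => //; first exact: subset_trans BA.
  rewrite C0/= exprS invfM mulrCA mulrC (le_trans Cn)//.
  by rewrite ler_pM2r.
have [n hn] : exists n, m A / 2 ^+ n < e.
  exists (Num.bound (m A / e)); rewrite ltr_pdivrMr ?exprn_gt0// mulrC -ltr_pdivrMr//.
  apply: lt_trans (archi_boundP (ltW (divr_gt0 A0 e0))) _.
  by rewrite -natrX ltr_nat ltn_expl.
have [B [mB BA /andP[B0 Bn]]] := iter n.
by exists B; split => //; rewrite B0 (le_lt_trans Bn).
Qed.

(** Greedy exhaustion: keep adding a set that is at least half as large as any
set that still fits under the measure [c]. The added measures are summable, so
they tend to zero; if the union stayed below [c], a small set of positive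
measure would fit at every stage, which is impossible. *)
Lemma nonatomic_subset_measure A c : measurable A -> 0 <= c <= m A ->
  exists B, [/\ measurable B, B `<=` A & m B = c].
Proof.
move=> mA /andP[c0 cA].
pose adm E B := [/\ measurable B, B `<=` A `\` E & m E + m B <= c].
have step E : measurable E -> m E <= c ->
    exists B, adm E B /\ forall B', adm E B' -> m B' <= 2 * m B.
  move=> mE Ec; pose S := [set m B | B in adm E].
  have adm0 : adm E set0 by split => //; rewrite measure0/= addr0.
  have supS : has_sup S.
    split; first by exists (m set0); exists set0.
    by exists c => _ [B [_ _ Bc] <-]; apply: le_trans Bc; rewrite lerDr fmu_ge0.
  have le_sup B : adm E B -> m B <= sup S.
    by move=> aB; apply: sup_upper_bound => //; exists B.
  have [s0|s0] := leP (sup S) 0.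
    exists set0; split => // B /le_sup/le_trans; apply.
    by rewrite measure0/= mulr0.
  have [_ [B aB <-] hB] : exists2 x, S x & sup S - sup S / 2 < x.
    by apply: sup_adherent => //; rewrite divr_gt0.
  by exists B; split => // B' /le_sup; lra.
(* The sets reached by the exhaustion carry their invariant in a sigma type, so
that the successor can be chosen by [choice]. *)
pose st E := [/\ measurable E, E `<=` A & m E <= c].
have next (E : {E | st E}) : exists B, adm (sval E) B /\
    forall B', adm (sval E) B' -> m B' <= 2 * m B.
  by case: E => E [mE EA Ec]; exact: step.
have [h hh] := choice next.
have stU (E : {E | st E}) : st (sval E `|` h E).
  have [[mB BAE Bc] _] := hh E; case: (svalP E) => mE EA Ec.
  have EB : sval E `&` h E = set0.
    by apply/seteqP; split => x//= [Ex /BAE[_]].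
  split; first exact: measurableU.
  - by rewrite subUset; split => //; apply: subset_trans BAE _; exact: subDsetl.
  - by rewrite fmuU.
have st0 : st set0 by split => //; rewrite measure0.
pose F := fix F n : {E | st E} :=
  if n is n'.+1 then exist _ _ (stU (F n')) else exist _ _ st0.
pose E n := sval (F n).
have mE n : measurable (E n) by case: (svalP (F n)).
have EA n : E n `<=` A by case: (svalP (F n)).
have Ec n : m (E n) <= c by case: (svalP (F n)).
have ES n : E n.+1 = E n `|` h (F n) by [].
have mES n : m (E n.+1) = m (E n) + m (h (F n)).
  have [[mB BAE Bc] _] := hh (F n).
  by rewrite ES fmuU//; apply/seteqP; split => x//= [Ex /BAE[_]].
have Emono : {homo E : a b / (a <= b)%N >-> (a <= b)%O}.
  apply: homo_leq => //; first by move=> ? ? ?; exact: le_trans.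
  by move=> n; apply/subsetPset; rewrite ES; exact: subsetUl.
have mU : measurable (\bigcup_n E n) by exact: bigcupT_measurable.
have UA : \bigcup_n E n `<=` A by apply: bigcup_sub => n _.
have cvgE : m (E n) @[n --> \oo] --> m (\bigcup_n E n).
  apply: (@fine_cvg _ _ _ _ (mu \o E)); rewrite fineK ?fin_num_measure//.
  exact: nondecreasing_cvg_mu.
have Uc : m (\bigcup_n E n) <= c.
  rewrite -(cvg_lim _ cvgE)//; apply: limr_le; first by apply/cvg_ex; eexists; exact: cvgE.
  by near=> n.
exists (\bigcup_n E n); split => //; apply/eqP; rewrite eq_le Uc/= leNgt; apply/negP => ltc.
have [B [mB BAU /andP[B0 Bc]]] : exists B, [/\ measurable B,
    B `<=` A `\` \bigcup_n E n & 0 < m B < c - m (\bigcup_n E n)].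
  apply: nonatomic_small_subset; [exact: measurableD| |by rewrite subr_gt0].
  by rewrite fmuD// subr_gt0 (lt_le_trans ltc).
have leB n : m B <= 2 * (m (E n.+1) - m (E n)).
  rewrite mES addrAC subrr add0r; apply: (hh (F n)).2; split => //.
    by move=> x /BAU[Ax nUx]; split => // Ex; apply: nUx; exists n.
  have : m (E n) <= m (\bigcup_n E n) by apply: le_fmu => //; exact: bigcup_sup.
  by rewrite -/(E n); lra.
have cvgE1 : m (E n.+1) @[n --> \oo] --> m (\bigcup_n E n).
  by rewrite (cvg_shiftS (fun n => m (E n))); exact: cvgE.
have : (fun n => 2 * (m (E n.+1) - m (E n))) @ \oo -->
    2 * (m (\bigcup_n E n) - m (\bigcup_n E n)).
  by apply: cvgM; [exact: cvg_cst|exact: cvgB].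
rewrite subrr mulr0 => cvg0.
suff : m B <= 0 by rewrite leNgt B0.
rewrite -(cvg_lim _ cvg0)//; apply: limr_ge; first by apply/cvg_ex; eexists; exact: cvg0.
by near=> n.
Unshelve. all: by end_near. Qed.

End Sierpinski.

(** * Lyapunov's theorem for bounded densities *)

Lemma lipschitz_continuous (R : realType) (f : R -> R) L :
  (forall x y, x <= y -> `|f y - f x| <= L * (y - x)) -> continuous f.
Proof.
move=> fL x; apply/cvgrPdist_le => e e0; near=> y.
have L0 : 0 < `|L| + 1 by rewrite ltr_wpDl.
have xy : `|x - y| <= e / (`|L| + 1).
  by near: y; apply: cvgr_dist_le; [exact: cvg_id|rewrite divr_gt0].
have key : `|f x - f y| <= L * `|x - y|.
  case: (leP x y) => [xy'|/ltW xy'].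
    by rewrite distrC (distrC x) (ger0_norm (x := y - x)) ?subr_ge0//; exact: fL.
  by rewrite (ger0_norm (x := x - y)) ?subr_ge0//; exact: fL.
apply: le_trans key _; rewrite ler_pdivlMr// mulrC in xy; apply: le_trans xy.
by rewrite ler_wpM2r// (le_trans (ler_norm L))// lerDl.
Unshelve. all: by end_near. Qed.

Section Lyapunov.
Context {d : measure_display} {T : measurableType d} {R : realType}.
Variable mu : probability T R.
Implicit Types (A B E : set T).
Variable G : nat -> T -> R.
Hypothesis bG : forall j, bounded_measurable (G j).
(* The density 0 is the measure itself, so that fairness always controls the
measure of the parts. *)
Hypothesis G0 : G 0%N = fun=> 1.

Local Notation nu j A := (Rintegral mu setT (fun x => \1_A x * G j x)).

Lemma bmeas_nu j A : measurable A -> bounded_measurable (fun x => \1_A x * G j x).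
Proof. by move=> mA; apply: bmeasM => //; exact: bmeas_indic. Qed.

Lemma nu_set0 j : nu j set0 = 0.
Proof.
rewrite -[RHS](@Int_cst _ T R mu); congr Rintegral; apply/funext => x.
by rewrite indic0 mul0r.
Qed.

Lemma nu0E A : measurable A -> nu 0%N A = fine (mu A).
Proof.
by move=> mA; rewrite -Int_indic//; congr Rintegral; apply/funext => x; rewrite G0 mulr1.
Qed.

Definition fair_part k t A B := [/\ measurable B, B `<=` A &
  forall j, (j <= k)%N -> nu j B = t * nu j A].

Definition has_fair_halves k :=
  forall A, measurable A -> exists B, fair_part k 2^-1 A B.

(** Halve repeatedly. The set at level [t] is the union, over [n], of the first
[i] of the [2 ^ n] pieces obtained by [n] rounds of halving, where [i / 2 ^ n] is
the dyadic approximation of [t] from below; these unions increase with [n]. *)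
Lemma fair_family k A : has_fair_halves k -> measurable A ->
  exists E : R -> set T, [/\ forall s t, s <= t -> E s `<=` E t,
    E 0 = set0, E 1 = A &
    forall t : R, 0 <= t <= 1 -> fair_part k t A (E t)].
Proof.
move=> half mA.
have hex B : exists C, measurable B -> fair_part k 2^-1 B C.
  have [mB|nmB] := pselect (measurable B); last by exists set0.
  by have [C CP] := half _ mB; exists C.
have [h hP] := choice hex.
pose E := fix E n i := if n is n'.+1 then
    if odd i then E n' i./2 `|` h (E n' i./2.+1 `\` E n' i./2) else E n' i./2
  else if i is 0%N then set0 else A.
have ES n i : E n.+1 i =
  if odd i then E n i./2 `|` h (E n i./2.+1 `\` E n i./2) else E n i./2 by [].
have mE n i : measurable (E n i).
  elim: n i => [[|i]|n IH i]; [exact: measurable0|exact: mA|].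
  rewrite ES; case: ifP => // _.
  apply: measurableU => //.
  by have [] := hP (E n i./2.+1 `\` E n i./2) (measurableD (IH _) (IH _)).
have Emono1 n i : E n i `<=` E n i.+1.
  elim: n i => [[|i]|n IH i]; [exact: sub0set|by []|].
  rewrite !ES /=; have [oi|ei] /= := boolP (odd i).
    rewrite uphalf_half oi add1n subUset; split; first exact: IH.
    have [_ /subset_trans + _] := hP _ (measurableD (mE n i./2.+1) (mE n i./2)).
    by apply; exact: subDsetl.
  rewrite uphalf_half (negbTE ei) add0n; exact: subsetUl.
have Emono n i j : (i <= j)%N -> E n i `<=` E n j.
  move=> /subnK <-; elim: (j - i)%N => [//|l IH]; rewrite addSn.
  exact: subset_trans IH (Emono1 _ _).
have Edbl n i : E n.+1 i.*2 = E n i by rewrite ES odd_double doubleK.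
have E0 n : E n 0 = set0 by elim: n => // n IH; rewrite ES.
have EA n i : E n i `<=` A.
  elim: n i => [[|i]|n IH i]; [exact: sub0set|by []|].
  rewrite ES; case: ifP => // _; rewrite subUset; split => //.
  have [_ /subset_trans + _] := hP _ (measurableD (mE n i./2.+1) (mE n i./2)); apply.
  exact: subset_trans (IH _).
have Enu n i j : (i <= 2 ^ n)%N -> (j <= k)%N -> nu j (E n i) = i%:R / 2 ^+ n * nu j A.
  move=> + jk; elim: n i => [[|[|]]//|n IH i]; rewrite ?E0 ?nu_set0 ?mul0r ?divr1 ?mul1r//.
  rewrite expnS mul2n => i2.
  have i2n : (i./2 <= 2 ^ n)%N.
    by rewrite -leq_double (leq_trans _ i2)// -[leqRHS]odd_double_half leq_addl.
  rewrite ES; have [oi|ei] := boolP (odd i); last first.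
    rewrite IH// -[in RHS](odd_double_half i) (negbTE ei) add0n -muln2 natrM exprS.
    by rewrite invfM mulrA mulfK.
  have i2n1 : (i./2.+1 <= 2 ^ n)%N.
    by rewrite -ltn_double (leq_trans _ i2)// -[leqRHS]odd_double_half oi.
  have [mh hsub hnu] := hP _ (measurableD (mE n i./2.+1) (mE n i./2)).
  have -> : nu j (E n i./2 `|` h (E n i./2.+1 `\` E n i./2)) =
      nu j (E n i./2) + nu j (h (E n i./2.+1 `\` E n i./2)).
    set D := h _ in mh hsub hnu *.
    have UD : (E n i./2 `|` D) `\` D = E n i./2.
      apply/seteqP; split => x /=; first by move=> [[]].
      by move=> Ex; split; [left|move=> /hsub[]].
    rewrite -{2}UD (Int_indicD _ (bG j)); first by ring.
    - exact: measurableU.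
    - exact: mh.
    - exact: subsetUr.
  rewrite hnu// Int_indicD// !IH//.
  rewrite -[in RHS](odd_double_half i) oi -muln2 natrD natrM exprS -(addn1 i./2) natrD.
  rewrite (_ : true%:R = 1 :> R)//; set X := Rintegral _ _ _; by field.
pose a (t : R) n := Num.truncn (2 ^+ n * t).
have aS (t : R) n : ((a t n).*2 <= a t n.+1)%N.
  rewrite /a; have [t0|t0] := leP 0 t; last first.
    rewrite (_ : Num.truncn (2 ^+ n * t) = 0)%N//; apply/truncn0Pn; rewrite -ltNge.
    by apply: lt_le_trans ler01; rewrite pmulr_rlt0// exprn_gt0.
  have e0 l : 0 <= 2 ^+ l * t by rewrite mulr_ge0// exprn_ge0.
  rewrite truncn_ge_nat// -mul2n natrM exprS -mulrA ler_pM2l//.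
  by rewrite truncn_le.
pose F (t : R) := \bigcup_n E n (a t n).
have mF t : measurable (F t) by apply: bigcupT_measurable.
exists F; split.
- move=> s t st; apply: subset_bigcup => n _; apply: Emono; apply: le_truncn.
  by rewrite ler_wpM2l// exprn_ge0.
- by rewrite /F bigcup0// => n _; rewrite /a mulr0 truncn0.
- apply/seteqP; split; first by apply: bigcup_sub => n _; exact: EA.
  by move=> x Ax; exists 0%N => //; rewrite /a expr0 mulr1 truncn1.
move=> t /andP[t0 t1]; split => //; first by apply: bigcup_sub => n _; exact: EA.
move=> j jk.
have [_ [M GM]] := bG j.
have cvg1 : nu j (E n (a t n)) @[n --> \oo] --> nu j (F t).
  apply: (@cvg_Int_eventually _ _ _ mu (fun n x => \1_(E n (a t n)) x * G j x) _ M).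
  - by move=> n; exact: bmeas_nu.
  - exact: bmeas_nu.
  - move=> n x; rewrite indicE; case: (_ \in _); rewrite ?mul1r ?mul0r//.
    by rewrite normr0; apply: le_trans (GM x).
  - move=> x; have [[n _ nx]|nFx] := pselect (F t x).
      near=> l; have nl : (n <= l)%N by near: l; exact: nbhs_infty_ge.
      rewrite !indicE mem_set; last first.
        move: nl => /subnK <-; elim: (l - n)%N => [//|q IH]; rewrite addSn.
        by apply: Emono (aS t _) _ _; rewrite Edbl.
      by rewrite mem_set//; exists n.
    near=> l; rewrite !indicE !memNset// => Ex; apply: nFx; by exists l.
have aitv n : (a t n)%:R <= 2 ^+ n * t < (a t n).+1%:R.
  by apply: truncn_itv; rewrite mulr_ge0// exprn_ge0.
have p0 n : 0 < 2 ^+ n :> R by rewrite exprn_gt0.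
have an n : (a t n <= 2 ^ n)%N.
  rewrite -(ler_nat R) natrX; have /andP[/le_trans + _] := aitv n; apply.
  by rewrite ler_piMr// ltW.
have cvga : (a t n)%:R / 2 ^+ n @[n --> \oo] --> t.
  apply/cvgrPdist_le => e e0; near=> n.
  have /andP[l1 l2] := aitv n.
  rewrite ger0_norm ?subr_ge0 ?ler_pdivrMr// 1?mulrC//.
  have : (2^-1 : R) ^+ n <= e.
    rewrite -[leLHS]ger0_norm ?exprn_ge0 ?invr_ge0//.
    near: n.
    have : `|2^-1 : R| < 1 by rewrite ger0_norm ?invr_ge0// invf_lt1// ltr1n.
    move=> /cvg_expr/cvgrPdist_le/(_ _ e0); apply: filterS => n.
    by rewrite sub0r normrN.
  apply: le_trans; rewrite exprVn lerBlDr.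
  rewrite [leRHS](_ : _ = (a t n).+1%:R / 2 ^+ n); last first.
    by rewrite -[in RHS]addn1 natrD; field; rewrite gt_eqF.
  by rewrite ler_pdivlMr// mulrC ltW.
have cvg2 : nu j (E n (a t n)) @[n --> \oo] --> t * nu j A.
  under eq_fun do rewrite Enu//.
  by apply: cvgM => //; exact: cvg_cst.
exact: (cvg_unique _ cvg1 cvg2).
Unshelve. all: by end_near. Qed.

(** Moving a window of length 1/2 from one end of the family to the other changes
its [k.+1]-st mass from one value to the complementary one with respect to
[nu k.+1 A]; half of [nu k.+1 A] lies in between. *)
Lemma fair_halvesS k : has_fair_halves k -> has_fair_halves k.+1.
Proof.
move=> half A mA; have [E [Emono E0 E1 EP]] := fair_family half mA.
have [_ [M GM]] := bG k.+1.
have M0 : 0 <= M by apply: le_trans (GM point).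
(* Clamping the parameter to [0, 1] makes the mass function continuous on the
whole line. *)
pose c (t : R) : R := Num.max 0 (Num.min t 1).
have cE (t : R) : [\/ t <= 0 /\ c t = 0, 0 <= t <= 1 /\ c t = t | 1 <= t /\ c t = 1].
  have [t0|t0] := leP t 0.
    by apply: Or31; rewrite /c min_l ?(le_trans t0)// max_l.
  have [t1|t1] := leP t 1; first by apply: Or32; rewrite /c min_l// max_r ltW.
  by apply: Or33; rewrite /c min_r ?max_r// ltW.
have c01 t : 0 <= c t <= 1.
  by apply/andP; case: (cE t) => -[h ->]; split; lra.
have cle s t : s <= t -> 0 <= c t - c s <= t - s.
  move=> st; apply/andP.
  by case: (cE t) => -[h ->]; case: (cE s) => -[h' ->]; split; lra.
pose P t := nu k.+1 (E (c t)).
have cP : continuous P.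
  apply: (@lipschitz_continuous _ _ M) => s t st.
  have [mt tA nut] := EP _ (c01 t); have [ms sA nus] := EP _ (c01 s).
  have /andP[cst cst'] := cle _ _ st; rewrite subr_ge0 in cst.
  rewrite /P -Int_indicD//; last exact: Emono.
  apply: (le_trans (Int_norm_le mu (bG _) (measurableD mt ms) GM)).
  rewrite ler_wpM2l// fmuD//; last exact: Emono.
  rewrite -!nu0E// nut// nus// -mulrBl; apply: le_trans cst'.
  rewrite ler_piMr ?subr_ge0// nu0E// -lee_fin fineK ?fin_num_measure//.
  exact: probability_le1.
have cQ : continuous (fun t : R => P (t + 2^-1) - P t).
  move=> t; apply: cvgB; last exact: cP.
  apply: (@cvg_comp _ _ _ (fun t : R => t + 2^-1) P); last exact: cP.
  by apply: cvgD; [exact: cvg_id|exact: cvg_cst].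
have cid t : 0 <= t <= 1 -> c t = t by case: (cE t) => -[h ->]; lra.
have c1 : c 1 = 1 by apply: cid; rewrite ler01 lexx.
have c0 : c 0 = 0 by apply: cid; rewrite ler01 lexx.
have P0 : P 0 = 0 by rewrite /P c0 E0 nu_set0.
have P1 : P 1 = nu k.+1 A by rewrite /P c1 E1.
have h11 : 2^-1 + 2^-1 = 1 :> R by field.
have h0 : 0 <= 2^-1 :> R by rewrite invr_ge0.
have := @IVT R _ 0 2^-1 (nu k.+1 A / 2) h0 (continuous_subspaceT cQ).
rewrite /= add0r P0 h11 P1 subr0.
set x := P _; set y := Rintegral _ _ _.
have -> : Num.min x (y - x) <= y / 2 <= Num.max x (y - x).
  by case: (leP x (y - x)) => h; apply/andP; split; lra.
move=> /(_ isT)[s]; rewrite in_itv/= => /andP[s0 s1] sP.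
have cs : c s = s by apply: cid; apply/andP; split; lra.
have cs' : c (s + 2^-1) = s + 2^-1 by apply: cid; apply/andP; split; lra.
have [|mt tA nut] := EP (s + 2^-1); first by apply/andP; split; lra.
have [|ms sA nus] := EP s; first by apply/andP; split; lra.
have sub : E s `<=` E (s + 2^-1) by apply: Emono; lra.
exists (E (s + 2^-1) `\` E s); split; first exact: measurableD.
  by apply: subset_trans tA; exact: subDsetl.
move=> j; rewrite leq_eqVlt => /orP[/eqP->|]; rewrite Int_indicD//.
  by move: sP; rewrite /P cs cs' -/y mulrC.
by rewrite ltnS => jk; rewrite nut// nus//; ring.
Qed.

Hypothesis hmu : nonatomic mu.

Lemma fair_halves k : has_fair_halves k.
Proof.
elim: k => [A mA|k]; last exact: fair_halvesS.
have [|B [mB BA mBA]] := nonatomic_subset_measure hmu (c := 2^-1 * fine (mu A)) mA.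
  by rewrite mulr_ge0 ?invr_ge0 ?fmu_ge0//= ler_piMl ?fmu_ge0// invf_le1 ?ler1n.
exists B; split => // j; rewrite leqn0 => /eqP ->.
by rewrite !nu0E.
Qed.

End Lyapunov.

Lemma lyapunov_scaling d (T : measurableType d) (R : realType)
    (mu : probability T R) (r : nat) (g : 'I_r -> T -> R) (t : R) :
  nonatomic mu -> (forall i, bounded_measurable (g i)) -> 0 <= t <= 1 ->
  exists2 B, measurable B &
    forall i, Rintegral mu setT (fun x => \1_B x * g i x) = t * Rintegral mu setT (g i).
Proof.
move=> hmu bg t01.
pose G j : T -> R := if j is j'.+1 then
  (if insub j' is Some i then g i else fun=> 0) else fun=> 1.
have bG j : bounded_measurable (G j).
  case: j => [|j]; first exact: bmeas_cst.
  by rewrite /G; case: insubP => [i _ _|_]; [exact: bg|exact: bmeas_cst].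
have [E [_ _ _ EP]] := fair_family bG (fair_halves bG erefl hmu r) measurableT.
have [mE _ nuE] := EP _ t01.
exists (E t) => // i; have := nuE i.+1 (ltn_ord i).
rewrite /G valK => ->; congr (_ * _).
by congr Rintegral; apply/funext => x; rewrite indicT mul1r.
Qed.

(** * Measurable selectors *)

Section Selectors.
Context {d : measure_display} {T : measurableType d} {R : realType} {N : nat}.
Implicit Types (D P : 'I_N -> T -> bool) (s : 'I_N -> T -> R) (a : T -> 'I_N).

Definition measurable_family D := forall i, measurable [set x | D i x].

Definition selector D a :=
  measurable_family (fun i x => a x == i) /\ forall x, D (a x) x.

(** The selected index is a function of the finite vector of truth values
[P i x], whose level sets are measurable. *)
Lemma exists_selector P : measurable_family P -> (forall x, exists i, P i x) ->
  exists a, selector P a.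
Proof.
move=> mP exP; pose sig x : {ffun 'I_N -> bool} := [ffun i => P i x].
have exi x : exists i, sig x i by have [i Pi] := exP x; exists i; rewrite ffunE.
exists (fun x => xchoose (exi x)); split; last first.
  by move=> x; have := xchooseP (exi x); rewrite {1}ffunE.
move=> i.
have -> : [set x | xchoose (exi x) == i] =
    \bigcup_(v in [set v | exists x, sig x = v /\ xchoose (exi x) = i])
      [set x | sig x = v].
  apply/seteqP; split => x /=.
    by move=> /eqP xi; exists (sig x) => //; exists x.
  move=> [_ [y [<- yi]] xy] /=; apply/eqP; rewrite -yi.
  by apply: eq_xchoose => j; rewrite xy.
apply: fin_bigcup_measurable; first exact: finite_finset.
move=> v _.
have -> : [set x | sig x = v] = \bigcap_(j in [set: 'I_N]) [set x | P j x = v j].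
  apply/seteqP; split => x /=; first by move=> <- j _ /=; rewrite ffunE.
  by move=> H; apply/ffunP => j; rewrite ffunE; exact: H.
apply: fin_bigcap_measurable; first exact: finite_finset.
move=> j _; case: (v j); first exact: mP.
rewrite (_ : [set x | _] = ~` [set x | P j x]); first exact: measurableC.
by apply/seteqP; split => x /=; [move=> ->|move/negP/negbTE].
Qed.

Definition argmax D s : 'I_N -> T -> bool :=
  fun i x => D i x && [forall j, D j x ==> (s j x <= s i x)].

Lemma argmaxP D s i x :
  reflect (D i x /\ forall j, D j x -> s j x <= s i x) (argmax D s i x).
Proof.
apply: (iffP andP) => -[Di]; first by move=> /forallP H; split => // j; exact/implyP.
by move=> H; split => //; apply/forallP => j; apply/implyP; exact: H.
Qed.

Lemma measurable_argmax D s : measurable_family D ->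
  (forall i, measurable_fun setT (s i)) -> measurable_family (argmax D s).
Proof.
move=> mD ms i.
have -> : [set x | argmax D s i x] = [set x | D i x] `&`
    \bigcap_(j in [set: 'I_N]) (~` [set x | D j x] `|` [set x | s j x <= s i x]).
  apply/seteqP; split => x /=.
    move=> /argmaxP[Di H]; split => // j _ /=.
    by have [Dj|nDj] := boolP (D j x); [right; exact: H|left].
  by move=> [Di H]; apply/argmaxP; split => // j Dj; have [] := H j I.
apply: measurableI => //; apply: fin_bigcap_measurable; first exact: finite_finset.
move=> j _; apply: measurableU; first exact: measurableC.
by rewrite -[X in measurable X]setTI; apply: measurable_fun_le.
Qed.

Lemma argmax_inhabited D s x : (exists i, D i x) -> exists i, argmax D s i x.
Proof.
move=> [i Di]; case: (@Order.TotalTheory.arg_maxP _ _ _ i (D^~ x) (s^~ x) Di) => j Dj H.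
by exists j; apply/argmaxP.
Qed.

Lemma bmeas_select s a : (forall i, bounded_measurable (s i)) ->
  measurable_family (fun i x => a x == i) ->
  bounded_measurable (fun x => s (a x) x).
Proof.
move=> bs ma.
rewrite (_ : (fun _ => _) = fun x => \sum_i (a x == i)%:R * s i x).
  by apply: bmeas_sum => i; apply: bmeasM => //; exact: bmeas_bool.
apply/funext => x; rewrite (bigD1 (a x))//= eqxx mul1r big1 ?addr0// => i.
by rewrite eq_sym => /negbTE ->; rewrite mul0r.
Qed.

(** Maximizing [w + k u] amounts, for [k] large, to maximizing [u] first and then
[w]. How large [k] has to be depends on the point [x]. *)
Lemma argmax_perturb D (u w : 'I_N -> T -> R) (x : T) (b : nat -> 'I_N) i :
  argmax (argmax D u) w i x ->
  (forall k, argmax D (fun j y => w j y + k%:R * u j y) (b k) x) ->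
  \forall k \near \oo, w (b k) x = w i x.
Proof.
move=> /argmaxP[/argmaxP[Di umax] wmax] bP.
(* Past this bound, an index with a smaller [u] cannot make up for it by its
value of [w]. *)
pose bd j := Num.bound (`|w j x - w i x| / (u i x - u j x)).
pose K := (\max_j bd j)%N.
near=> k; have Kk : (K <= k)%N by near: k; exact: nbhs_infty_ge.
have /argmaxP[Db bmax] := bP k; set j := b k in Db bmax *.
have ij := bmax _ Di.
have uji : u j x = u i x.
  apply/eqP; rewrite eq_le umax//= leNgt; apply/negP => uij.
  have uij0 : 0 < u i x - u j x by rewrite subr_gt0.
  have /archi_boundP : 0 <= `|w j x - w i x| / (u i x - u j x) by rewrite divr_ge0// ltW.
  rewrite ltNge => /negP; apply; rewrite ler_pdivlMr//.
  apply: (@le_trans _ _ (k%:R * (u i x - u j x))).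
    rewrite ler_pM2r// ler_nat; apply: leq_trans Kk.
    exact: (leq_bigmax (F := bd)).
  by apply: le_trans (ler_norm _); lra.
apply/eqP; rewrite eq_le; apply/andP; split.
  by apply: wmax; apply/argmaxP; split => // l Dl; rewrite uji; exact: umax.
by move: ij; rewrite uji lerD2r.
Unshelve. all: by end_near. Qed.

End Selectors.

(** * Payoffs of selectors *)

Section Attainment.
Context {d : measure_display} {T : measurableType d} {R : realType} {n : nat}.
Variables (mu : probability T R) (psi : 'I_n.+1 -> T -> R).
Hypothesis hmu : nonatomic mu.
Hypothesis bpsi : forall i, bounded_measurable (psi i).
Local Notation Int f := (Rintegral mu setT f).
Implicit Types (D : 'I_n.+1 -> T -> bool) (a : T -> 'I_n.+1) (m p q : 'rV[R]_n.+1).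

Definition payoff a : 'rV[R]_n.+1 := \row_i Int (fun x => (a x == i)%:R * psi i x).

Definition payoffs D : set 'rV[R]_n.+1 := payoff @` [set a | selector D a].

Definition score p (i : 'I_n.+1) (x : T) : R := p ord0 i * psi i x.

Lemma bmeas_score p i : bounded_measurable (score p i).
Proof. by apply: bmeasM => //; exact: bmeas_cst. Qed.

Lemma dotv_payoff D a p : selector D a ->
  dotv (payoff a) p = Int (fun x => score p (a x) x).
Proof.
move=> [ma _]; rewrite /dotv.
under eq_bigr => i _.
  rewrite mxE mulrC -IntZ; last by apply: bmeasM => //; exact: bmeas_bool.
  over.
rewrite -Int_sum; last first.
  move=> i; apply: bmeasM; first exact: bmeas_cst.
  by apply: bmeasM => //; exact: bmeas_bool.
congr Rintegral; apply/funext => x; rewrite (bigD1 (a x))//= eqxx mul1r big1 ?addr0// => i.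
by rewrite eq_sym => /negbTE ->; rewrite mul0r mulr0.
Qed.

Lemma argmax_payoff_max D a b p : selector (argmax D (score p)) a -> selector D b ->
  dotv (payoff b) p <= dotv (payoff a) p.
Proof.
move=> sa sb; rewrite (dotv_payoff p sa) (dotv_payoff p sb).
apply: le_Int => [||x]; [apply: bmeas_select sb.1|apply: bmeas_select sa.1|].
- exact: bmeas_score.
- exact: bmeas_score.
by have /argmaxP[_] := sa.2 x; apply; exact: sb.2.
Qed.

(** Use the first selector on a set [B] and the second one outside. The payoff is
that of the second one plus the integral over [B] of the difference of the
densities, so [B] has to scale these differences by [t]. *)
Lemma payoffs_convex D : convex_rV (payoffs D).
Proof.
move=> _ _ t [a [ma Da] <-] [b [mb Db] <-] t01.
pose g (i : 'I_n.+1) x := (a x == i)%:R * psi i x - (b x == i)%:R * psi i x : R.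
have bga i : bounded_measurable (fun x => (a x == i)%:R * psi i x).
  by apply: bmeasM => //; exact: bmeas_bool.
have bgb i : bounded_measurable (fun x => (b x == i)%:R * psi i x).
  by apply: bmeasM => //; exact: bmeas_bool.
have bg i : bounded_measurable (g i) by exact: bmeasB.
have [B mB BP] := lyapunov_scaling hmu bg t01.
exists (fun x => if x \in B then a x else b x).
  split; last by move=> x; case: ifP.
  move=> i.
  rewrite (_ : [set x | _] = (B `&` [set x | a x == i]) `|` (~` B `&` [set x | b x == i])).
    by apply: measurableU; apply: measurableI => //; exact: measurableC.
  apply/seteqP; split => x /=; case: ifPn => xB.
  - by left; split => //; exact: set_mem.
  - by right; split => //; move/mem_set; exact/negP.
  - by case => -[] //; have := set_mem xB.
  - by case => -[] // /mem_set; rewrite (negbTE xB).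
apply/rowP => i; rewrite !mxE.
have -> : t * Int (fun x => (a x == i)%:R * psi i x) +
    (1 - t) * Int (fun x => (b x == i)%:R * psi i x) =
    t * Int (g i) + Int (fun x => (b x == i)%:R * psi i x).
  by rewrite IntB//; ring.
rewrite -BP -IntD//; last by apply: bmeasM => //; exact: bmeas_indic.
congr Rintegral; apply/funext => x; rewrite indicE /g.
by case: (x \in B); rewrite ?mul1r ?mul0r ?add0r ?subrK.
Qed.

(** Equivalent to [dotv m p] being at most the support function of the payoffs at
[p], for every [p]; this form needs no expression for that function. *)
Definition unseparated D m :=
  forall p, exists2 s, payoffs D s & dotv m p <= dotv s p.

(** For each [k], a maximizer of [q + k p] gains at least as much as [m] against
[q + k p] and at most as much against [p], hence at least as much against [q].
Its payoff against [q] converges to that of a selector which maximizes [p] first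
and then [q], and this one is confined to the face. *)
Lemma unseparated_face D m p : measurable_family D -> (forall x, exists i, D i x) ->
  unseparated D m -> (forall s, payoffs D s -> dotv s p <= dotv m p) ->
  unseparated (argmax D (score p)) m.
Proof.
move=> mD exD mK pmax q.
have ms r i : measurable_fun setT (score r i) by exact: (bmeas_score r i).1.
have mDp := measurable_argmax mD (ms p).
have exDp x := argmax_inhabited (score p) (exD x).
have mDpq := measurable_argmax mDp (ms q).
have exDpq x := argmax_inhabited (score q) (exDp x).
have [a [ma aP]] := exists_selector mDpq exDpq.
have sa : selector (argmax D (score p)) a by split => // x; have /argmaxP[] := aP x.
exists (payoff a); first by exists a.
have hb k : exists b, selector (argmax D (score (q + k%:R *: p))) b.
  apply: exists_selector; first exact: measurable_argmax.
  by move=> x; exact: argmax_inhabited.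
have [b bP] := choice hb.
have sD k : selector D (b k).
  by split; [exact: (bP k).1|move=> x; have /argmaxP[] := (bP k).2 x].
have le_k k : dotv m q <= dotv (payoff (b k)) q.
  have [_ [c cD <-]] := mK (q + k%:R *: p).
  move=> /le_trans/(_ (argmax_payoff_max (bP k) cD)).
  rewrite !dotvDr !dotvZr => h.
  have : k%:R * dotv (payoff (b k)) p <= k%:R * dotv m p.
    by rewrite ler_wpM2l//; apply: pmax; exists (b k) => //; exact: sD.
  by move: h; lra.
have bs := bmeas_score q.
have [M MP] : exists M : R, forall i x, `|score q i x| <= M.
  have [M MP] := choice (fun i => (bs i).2).
  exists (\sum_i `|M i|) => i x; apply: le_trans (MP i x) _.
  by apply: le_trans (ler_norm _) _; rewrite (bigD1 i)//= lerDl sumr_ge0.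
have cvgb : dotv (payoff (b k)) q @[k --> \oo] --> dotv (payoff a) q.
  rewrite (dotv_payoff q sa); under eq_fun do rewrite (dotv_payoff q (sD _)).
  apply: (@cvg_Int_eventually _ _ _ mu (fun k x => score q (b k x) x) _ M).
  - by move=> k; apply: bmeas_select => //; exact: (bP k).1.
  - exact: bmeas_select.
  - by move=> k x; exact: MP.
  - move=> x; apply: (argmax_perturb (b := fun k => b k x) (aP x)) => k.
    have /argmaxP[Db bmax] := (bP k).2 x; apply/argmaxP; split => // j Dj.
    have := bmax _ Dj; rewrite /score !mxE.
    by rewrite !mulrDl -!mulrA.
rewrite -(cvg_lim _ cvgb)//; apply: limr_ge; first by apply/cvg_ex; eexists; exact: cvgb.
by near=> k.
Unshelve. all: by end_near. Qed.

(** The row space of [U] collects the directions on which all the payoffs agree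
with [m]. A supporting functional orthogonal to it enlarges it, so the induction
is on its codimension. *)
Lemma unseparated_attained D m : measurable_family D -> (forall x, exists i, D i x) ->
  unseparated D m -> payoffs D m.
Proof.
move=> mD exD mK.
have gen k : forall D (U : 'M[R]_n.+1), measurable_family D ->
    (forall x, exists i, D i x) -> unseparated D m ->
    (forall s u, payoffs D s -> (u <= U)%MS -> dotv (s - m) u = 0) ->
    (n.+1 - \rank U < k)%N -> payoffs D m; last first.
  apply: (gen n.+2 D 0) => //; last by rewrite mxrank0.
  by move=> s u _; rewrite submx0 => /eqP ->; rewrite /dotv big1// => i _; rewrite !mxE mulr0.
elim: k => // k IH {}D U {}mD {}exD {}mK perp rk; apply: contrapT => nm.
pose C := [set s - m | s in payoffs D].
have cC : convex_rV C.
  move=> _ _ t [x Sx <-] [y Sy <-] t01; exists (t *: x + (1 - t) *: y).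
    exact: payoffs_convex.
  by rewrite !scalerBr addrACA -opprD -scalerDl subrKC scale1r.
have [s0 Ss0 _] := mK 0.
have C0 : C !=set0 by exists (s0 - m), s0.
have nC0 : ~ C 0 by move=> [s Ss /subr0_eq sm]; apply: nm; rewrite -sm.
have [|p [p0 pU pmax]] :=
    support_functional (V := [set u | (u <= U)%MS]) cC C0 nC0.
  by move=> _ u [s Ss <-]; exact: perp.
have rkU : (\rank U < \rank (U + p)%MS)%N.
  apply: rank_ltmx; rewrite ltmxE addsmxSl/= addsmx_sub submx_refl/=.
  by apply/negP => /pU/eqP; rewrite dotv_eq0; exact/negP.
have pmax' s : payoffs D s -> dotv s p <= dotv m p.
  by move=> Ss; rewrite -subr_le0 -dotvNl -dotvDl; apply: pmax; exists s.
apply: nm; suff [a [ma Da] <-] : payoffs (argmax D (score p)) m.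
  by exists a => //; split => // x; have /argmaxP[] := Da x.
apply: (IH _ (U + p)%MS).
- by apply: measurable_argmax => // i; exact: (bmeas_score p i).1.
- by move=> x; exact: argmax_inhabited.
- exact: unseparated_face.
- move=> _ u [a sa <-] /sub_addsmxP[[u1 u2] /= ->].
  have sD : selector D a by split; [exact: sa.1|move=> x; have /argmaxP[] := sa.2 x].
  have Sa : payoffs D (payoff a) by exists a.
  rewrite dotvDr perp ?submxMl// add0r (mx11_scalar u2) mul_scalar_mx dotvZr.
  suff -> : dotv (payoff a - m) p = 0 by rewrite mulr0.
  apply/eqP; rewrite dotvDl dotvNl subr_eq0 eq_le pmax'//=.
  have [_ [b sb <-] mb] := mK p.
  exact: le_trans mb (argmax_payoff_max sa sb).
- move: rk; rewrite ltnS; apply: leq_trans; rewrite ltn_sub2l//.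
  by rewrite (leq_trans rkU)// rank_leq_col.
Qed.

End Attainment.

(** * Partitions and subpartitions *)

Section Xi0.
Context {R : realType} {X : ptopologicalType} {n : nat}.
Variable psi : 'I_n.+1 -> X -> R.

Lemma xi0_leP (x : X) (p : 'rV[R]_n.+1) c :
  xi0 psi x p <= c <-> forall i, p ord0 i * psi i x <= c.
Proof.
split=> [h i|h]; last by apply: bigmax_le => // i _.
by apply: le_trans h; exact: le_bigmax.
Qed.

Lemma le_xi0 (x : X) (p : 'rV[R]_n.+1) i : p ord0 i * psi i x <= xi0 psi x p.
Proof. by have /xi0_leP := lexx (xi0 psi x p); exact. Qed.

(** The index 0 of the padded family stands for the part of the space left
uncovered. *)
Definition pad_psi (i : 'I_n.+2) : X -> R :=
  if unlift ord0 i is Some j then psi j else fun=> 0.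

Definition pad (m : 'rV[R]_n.+1) : 'rV[R]_n.+2 :=
  \row_i (if unlift ord0 i is Some j then m ord0 j else 0).

Definition unpad (p : 'rV[R]_n.+2) : 'rV[R]_n.+1 := \row_j p ord0 (lift ord0 j).

Lemma padK : cancel pad unpad.
Proof. by move=> p; apply/rowP => j; rewrite !mxE liftK. Qed.

Lemma dotv_pad m p : dotv (pad m) p = dotv m (unpad p).
Proof.
rewrite /dotv big_ord_recl mxE unlift_none mul0r add0r.
by apply: eq_bigr => i _; rewrite !mxE liftK.
Qed.

End Xi0.

Lemma xi0_pad (R : realType) (X : ptopologicalType) n (psi : 'I_n.+1 -> X -> R) x p :
  xi0 (pad_psi psi) x p = xi0_plus psi x (unpad p).
Proof.
apply/eqP; rewrite eq_le; apply/andP; split.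
  apply/xi0_leP => i; rewrite /pad_psi /xi0_plus le_max.
  case: unliftP => [j ->|_]; last by rewrite mulr0 lexx orbT.
  by have := le_xi0 psi x (unpad p) j; rewrite mxE => ->.
rewrite /xi0_plus ge_max; apply/andP; split.
  apply/xi0_leP => j; have := le_xi0 (pad_psi psi) x p (lift ord0 j).
  by rewrite /pad_psi liftK mxE.
have := le_xi0 (pad_psi psi) x p ord0.
by rewrite /pad_psi unlift_none mulr0.
Qed.

Section Partitions.
Context {R : realType} {X : ptopologicalType} {n : nat}.
Variables (mu : probability (borelType X) R) (psi : 'I_n.+1 -> X -> R).
Local Notation Int f := (Rintegral mu setT f).
Implicit Types (m p : 'rV[R]_n.+1).

Lemma subpartition_pad m :
  subpartition_set mu psi m <-> partition_set mu (pad_psi psi) (pad m).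
Proof.
split=> -[A [mA covA A0 Am]].
  pose A' (i : 'I_n.+2) : set (borelType X) :=
    if unlift ord0 i is Some j then A j else ~` \bigcup_j A j.
  have A'0 j : A' ord0 `&` A j = set0.
    rewrite /A' unlift_none; apply/seteqP; split => x//= [nA Ax].
    by apply: nA; exists j.
  exists A'; split.
  - move=> i; rewrite /A'; case: unliftP => [j _|_]; first exact: mA.
    apply: measurableC; apply: fin_bigcup_measurable; first exact: finite_finset.
    by move=> j _; exact: mA.
  - apply/seteqP; split => x// _.
    have [[j _ Ax]|nA] := pselect ((\bigcup_j A j) x).
      by exists (lift ord0 j) => //; rewrite /A' liftK.
    by exists ord0 => //; rewrite /A' unlift_none.
  - move=> i j; have [i' ->|->] := unliftP ord0 i; have [j' ->|->] := unliftP ord0 j.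
    + rewrite (inj_eq lift_inj) /A' !liftK; exact: A0.
    + by move=> _; rewrite setIC {2}/A' liftK A'0 measure0.
    + by move=> _; rewrite {2}/A' liftK A'0 measure0.
    + by rewrite eqxx.
  - move=> i; rewrite mxE /pad_psi /A'; case: unliftP => [j _|_]; first exact: Am.
    by rewrite Int_setE; under eq_fun do rewrite mulr0; rewrite Int_cst.
exists (fun j => A (lift ord0 j)); split => //.
- by move=> i j ij; apply: A0; rewrite (inj_eq lift_inj).
- by move=> i; have := Am (lift ord0 i); rewrite mxE /pad_psi liftK.
Qed.

Hypothesis bpsi : forall i, @bounded_measurable _ (borelType X) R (psi i).

Lemma Xi0_argmax a p :
  selector (argmax (fun _ _ => true) (@score _ (borelType X) R n psi p)) a ->
  dotv (payoff mu psi a) p = Xi0 mu psi p.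
Proof.
move=> sa; rewrite (dotv_payoff mu bpsi p sa); congr Rintegral; apply/funext => x.
have /argmaxP[_ amax] := sa.2 x.
apply/eqP; rewrite eq_le le_xi0/=; apply/xi0_leP => i; exact: amax.
Qed.

(** The cells of a partition may overlap in null sets; the selector assigns each
point to one of the cells that contain it, which changes each cell by a null set
only. *)
Lemma partition_payoffs m :
  partition_set mu psi m <-> @payoffs _ (borelType X) R n mu psi (fun _ _ => true) m.
Proof.
split; last first.
  move=> [a [ma _] <-]; exists (fun i => [set x | a x == i]); split => //.
  - by apply/seteqP; split => x// _; exists (a x) => /=.
  - move=> i j ij; rewrite (_ : _ `&` _ = set0) ?measure0//.
    apply/seteqP; split => x//= -[/eqP -> /eqP ij'].
    by rewrite ij' eqxx in ij.
  - move=> i; rewrite Int_setE mxE; congr Rintegral; apply/funext => x.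
    rewrite indicE; congr (_%:R * _); congr nat_of_bool.
    by apply/idP/idP => [/set_mem|h]//; exact: mem_set.
move=> [A [mA covA A0 Am]].
have [a [ma aA]] : exists a, selector (fun i x => x \in A i) a.
  apply: exists_selector => [i|x].
    rewrite (_ : [set x | _] = A i)//.
    by apply/seteqP; split => x /=; [exact: set_mem|exact: mem_set].
  have [i _ Ai] : (\bigcup_i A i) x by rewrite covA.
  by exists i; exact: mem_set.
exists a; first by split.
apply/rowP => i; rewrite mxE -Am [RHS]Int_setE.
pose B : set (borelType X) := [set x | a x == i].
have mB : measurable B by exact: ma.
have BA : B `<=` A i by move=> x /eqP <-; apply: set_mem; exact: aA.
transitivity (Rintegral mu setT (fun x : borelType X => \1_B x * psi i x)).
  congr Rintegral; apply/funext => x; suff -> : (a x == i) = (x \in B) by [].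
  by apply/idP/idP => [h|/set_mem]//; exact: mem_set.
apply/esym/eqP; rewrite -subr_eq0 -Int_indicD//.
have [_ [M psiM]] := bpsi i.
rewrite -normr_le0; apply: le_trans (Int_norm_le mu (bpsi i) (measurableD (mA i) mB) psiM) _.
suff -> : fine (mu (A i `\` B)) = 0 by rewrite mulr0.
(* The sum of [h] dominates the indicator of the part of [A i] that was assigned
to other cells, and it integrates to zero. *)
pose h (j : 'I_n.+1) (x : borelType X) : R :=
  if j == i then 0 else \1_(A i `&` A j) x.
have mIJ j : measurable (A i `&` A j) by exact: measurableI.
have bh j : bounded_measurable (h j).
  by rewrite /h; case: (j == i); [exact: bmeas_cst|exact: bmeas_indic].
apply/eqP; rewrite eq_le fmu_ge0 andbT -Int_indic; last exact: measurableD.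
apply: (@le_trans _ _ (Int (fun x => \sum_j h j x))).
  apply: le_Int => [||x].
  - by apply: bmeas_indic; exact: measurableD.
  - exact: bmeas_sum.
  have h0 j : 0 <= h j x by rewrite /h; case: (j == i) => //; rewrite indicE.
  rewrite indicE; have [/set_mem[Ax nBx]|_] := boolP (_ \in _); last exact: sumr_ge0.
  rewrite (bigD1 (a x))//= {1}/h ifF; last by apply/negP => ax; exact: nBx.
  rewrite indicE mem_set ?lerDl ?sumr_ge0//; split => //; exact/set_mem/aA.
rewrite Int_sum// big1// => j _; rewrite /h; have [_|ji] := eqVneq j i.
  exact: Int_cst.
by rewrite Int_indic// A0// eq_sym.
Qed.

Hypothesis hmu : nonatomic mu.

Lemma partition_set_iff m :
  partition_set mu psi m <-> forall p, Xi0 mu psi p - dotv m p >= 0.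
Proof.
have mD : measurable_family (fun (_ : 'I_n.+1) (_ : borelType X) => true).
  by move=> i; rewrite (_ : [set x | _] = setT)//; apply/seteqP; split.
have exD (x : borelType X) : exists i : 'I_n.+1, true by exists ord0.
have ex_argmax p : exists a : borelType X -> _,
    selector (argmax (fun _ _ => true) (@score _ (borelType X) R n psi p)) a.
  apply: exists_selector; last by move=> x; apply: argmax_inhabited; exists ord0.
  by apply: measurable_argmax => // i; exact: (bmeas_score bpsi p i).1.
rewrite partition_payoffs; split => [[b sb <-] p|K].
  have [a sa] := ex_argmax p.
  by rewrite subr_ge0 -(Xi0_argmax sa); exact: argmax_payoff_max sb.
apply: unseparated_attained => // p; have [a sa] := ex_argmax p.
exists (payoff mu psi a); first by exists a => //; split => //; exact: sa.1.
by rewrite (Xi0_argmax sa) -subr_ge0.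
Qed.

End Partitions.

Lemma continuous_bounded_measurable (R : realType) (X : ptopologicalType) (f : X -> R) :
  compact [set: X] -> continuous f -> @bounded_measurable _ (borelType X) R f.
Proof.
move=> cX cf; split.
  apply: (measurability _ (RGenOpens.measurableE R)) => _ [_ [a [b ->] <-]].
  rewrite setTI; apply: sub_sigma_algebra.
  by move/continuousP: cf; apply; exact: interval_open.
have /compact_bounded[M [_ MP]] : compact (f @` setT).
  by apply: continuous_compact => //; exact: continuous_subspaceT.
by exists (M + 1) => x; apply: (MP (M + 1)); [rewrite ltrDl|exists x].
Qed.

Theorem theorem2p2 (R : realType) (X : ptopologicalType)
    (hpolish : polish_space R X) (hcompact : compact [set: X])
    (mu : probability (borelType X) R) (hmu : nonatomic mu)
    (n : nat) (psi : 'I_n.+1 -> X -> R) (hpsi : forall i, continuous (psi i))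
    (m : 'rV[R]_n.+1) :
  (partition_set mu psi m <->
     (forall p : 'rV[R]_n.+1, Xi0 mu psi p - dotv m p >= 0)) /\
  (subpartition_set mu psi m <->
     (forall p : 'rV[R]_n.+1, Xi0_plus mu psi p - dotv m p >= 0)).
Proof.
have bpsi i := continuous_bounded_measurable hcompact (hpsi i).
have bpad i : @bounded_measurable _ (borelType X) R (pad_psi psi i).
  by rewrite /pad_psi; case: unliftP => [j _|_]; [exact: bpsi|exact: bmeas_cst].
have Xi0E p : Xi0 mu (pad_psi psi) p - dotv (pad m) p =
    Xi0_plus mu psi (unpad p) - dotv m (unpad p).
  rewrite dotv_pad; congr (_ - _); congr Rintegral; apply/funext => x.
  exact: xi0_pad.
split; first exact: partition_set_iff.
rewrite subpartition_pad partition_set_iff//; split => K p; last by rewrite Xi0E.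
by have := K (pad p); rewrite Xi0E padK.
Qed.
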